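(* Let $n\ge 1$ be an integer, let $\alpha_j=1$ for $j=1,\dots,n+1$, and let $\nu_1,\dots,\nu_n\in\mathbb{C}$ be such that $a_j\notin\{-1,-2,-3,\dots\}$ for $j=1,\dots,n$. Then for all $z\in\mathbb{C}$ $$\mathcal{W}^{(\bar 1,\bar\nu)}(z)=\Big(\prod_{j=1}^n\Gamma(1+a_j)\Big)\,\mathcal{J}_{a_2,\dots,a_{n+1}}(-z),$$ where $\mathcal{J}_{a_2,\dots,a_{n+1}}$ is the hyper-Bessel function of order $n$ with indices $a_2,\dots,a_{n+1}$.
   Context: For parameters $\alpha_1,\dots,\alpha_{n+1}>0$, $\nu_1,\dots,\nu_n\in\mathbb{C}$, with the conventions $\alpha_0=\nu_0=0$, put for $j=1,\dots,n+1$ $$a_j=1+\sum_{m=1}^{j}(\nu_{m-1}-\alpha_m),\qquad b_j=1+\sum_{m=1}^{j}(\nu_{m-1}-\alpha_{m-1}),$$ so that $a_j=b_j-\alpha_j$. The multi-index special function is $$\mathcal{W}^{(\bar\alpha,\bar\nu)}(z)=\sum_{k=0}^\infty\left(\prod_{i=1}^k\prod_{j=1}^n\frac{\Gamma(\alpha_{n+1}i+a_j)}{\Gamma(\alpha_{n+1}i+b_j)}\right)\frac{z^k}{\Gamma(\alpha_{n+1}k+b_{n+1})},\qquad z\in\mathbb{C}.$$ $\mathcal{W}^{(\bar 1,\bar\nu)}$ denotes this function with all $\alpha_j=1$. The hyper-Bessel function of Delerue of order $d$ with indices $\mu_1,\dots,\mu_d$ (in its normalized form) is $$\mathcal{J}_{\mu_1,\dots,\mu_d}(z)=\sum_{k\ge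 0}\frac{(-1)^k z^k}{k!\,\prod_{j=1}^d\Gamma(k+\mu_j+1)}.$$ Here $1/\Gamma$ is the entire reciprocal gamma function (equal to $0$ at the poles of $\Gamma$), and empty products equal $1$. *)

(* Defs.v *)
From Stdlib Require Import Reals ZArith.
From Coquelicot Require Import Coquelicot.
Local Open Scope C_scope.

(* C carries two normed-module structures in Coquelicot: series use the one
   over C, integrals over real intervals the one over R. *)

(* The product of f i for lo <= i <= hi, equal to 1 when hi < lo. *)
Definition Cprod (f : nat -> C) (lo hi : nat) : C :=
  Iter.iter_nat Cmult (RtoC 1) f lo hi.

(* As for [RInt_gen], the value is meaningful only for a convergent series. *)
Definition CSeries (u : nat -> C) : C :=
  @iota C_CompleteNormedModule
    (@is_series C_AbsRing C_NormedModule u).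

Definition Cexp (z : C) : C :=
  RtoC (exp (Re z)) * (cos (Im z), sin (Im z)).

Definition Gamma_integral (z : C) : C :=
  @RInt_gen C_R_CompleteNormedModule
    (fun t : R => Cexp ((z - 1) * RtoC (ln t)) * RtoC (exp (- t)))
    (at_right 0) (Rbar_locally p_infty).

(* A number of unit steps bringing z into the half-plane 0 < Re z
   (no step if z is already there, since r < up r <= r + 1). *)
Definition Gamma_shift (z : C) : nat := Z.to_nat (up (- Re z)).

(* The product z (z + 1) ... (z + m - 1). *)
Definition Crising (z : C) (m : nat) : C :=
  Cprod (fun i => z + RtoC (INR i) - 1) 1 m.

(* Analytic continuation of the integral to C minus {0, -1, -2, ...} by
   Gamma (z + 1) = z Gamma z; the values at the poles are not meaningful. *)
Definition Gamma (z : C) : C :=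
  let m := Gamma_shift z in
  Gamma_integral (z + RtoC (INR m)) / Crising z m.

(* The entire function 1 / Gamma: at a pole of Gamma a factor of the
   numerator vanishes. *)
Definition RGamma (z : C) : C :=
  let m := Gamma_shift z in
  Crising z m / Gamma_integral (z + RtoC (INR m)).

(* Parameters are sequences of which only the terms of index >= 1 matter:
   [zero_ext_R] and [zero_ext_C] implement alpha_0 = nu_0 = 0. *)
Definition zero_ext_R (x : nat -> R) (m : nat) : R :=
  match m with O => 0%R | S _ => x m end.

Definition zero_ext_C (x : nat -> C) (m : nat) : C :=
  match m with O => RtoC 0 | S _ => x m end.

Definition a_par (alpha : nat -> R) (nu : nat -> C) (j : nat) : C :=
  1 + sum_n_m (fun m => zero_ext_C nu (m - 1) - RtoC (zero_ext_R alpha m)) 1 j.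

Definition b_par (alpha : nat -> R) (nu : nat -> C) (j : nat) : C :=
  1 + sum_n_m
        (fun m => zero_ext_C nu (m - 1) - RtoC (zero_ext_R alpha (m - 1))) 1 j.

(* The parameters of W are alpha 1, ..., alpha (n + 1), nu 1, ..., nu n. *)
Definition W_term (n : nat) (alpha : nat -> R) (nu : nat -> C) (z : C)
    (k : nat) : C :=
  Cprod (fun i => Cprod (fun j =>
      Gamma (RtoC (alpha (n + 1)%nat * INR i) + a_par alpha nu j) *
      RGamma (RtoC (alpha (n + 1)%nat * INR i) + b_par alpha nu j)) 1 n) 1 k *
  (z ^ k *
   RGamma (RtoC (alpha (n + 1)%nat * INR k) + b_par alpha nu (n + 1))).

Definition W (n : nat) (alpha : nat -> R) (nu : nat -> C) (z : C) : C :=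
  CSeries (W_term n alpha nu z).

(* The indices of the hyper-Bessel function are mu 1, ..., mu d. *)
Definition hyper_Bessel_term (d : nat) (mu : nat -> C) (z : C)
    (k : nat) : C :=
  RtoC (-1) ^ k * z ^ k / RtoC (INR (fact k)) *
  Cprod (fun j => RGamma (RtoC (INR k) + mu j + 1)) 1 d.

Definition hyper_Bessel (d : nat) (mu : nat -> C) (z : C) : C :=
  CSeries (hyper_Bessel_term d mu z).

(* Main.v *)
Require Import Defs.
From Stdlib Require Import Reals ZArith Lra Lia.
From Coquelicot Require Import Coquelicot.

(* When every alpha_j is 1, b_j = a_j + 1, so the product over i of
   Gamma (i + a_j) / Gamma (i + 1 + a_j) telescopes to
   Gamma (1 + a_j) / Gamma (k + 1 + a_j). Since a_1 = 0, its factor j = 1 gives the 1 / k!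
   of the hyper-Bessel series, and 1 / Gamma (k + b_{n+1}) supplies the index a_{n+1}.

   Telescoping needs Gamma to have no zeros. By the functional equation a zero z would
   make z + m a zero for every m, whereas for large x the integral of
   t ^ (x - 1) e ^ (-t) cos (y ln (t / x)) is positive, because
   cos u >= 1 - u^2 / 2 and (ln s)^2 <= s - 2 + 1 / s bound it below by
   Gamma x (1 - y^2 / (2 (x - 1))).

   Both series converge like the exponential series, since 1 / Gamma is bounded
   along w, w + 1, w + 2, ... *)

Local Open Scope R_scope.

(** * Improper real integrals over the open half-line $(0,\infty)$ *)

Definition is_RInt_pos (f : R -> R) (l : R) : Prop :=
  is_RInt_gen f (at_right 0) (Rbar_locally p_infty) l.

Lemma at_right_0_pos (d : R) : 0 < d -> at_right 0 (fun t => 0 < t < d).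
Proof.
  intros hd; exists (mkposreal d hd); intros t ht h0.
  unfold ball in ht; simpl in ht; unfold AbsRing_ball, abs, minus, plus, opp in ht;
    simpl in ht.
  apply Rabs_def2 in ht; lra.
Qed.

(** Lets every limit over pairs of endpoints assume $0<a<d<b$, so that integrands need only be
    controlled at positive arguments. *)
Lemma filter_prod_pos (d : R) : 0 < d ->
  filter_prod (at_right 0) (Rbar_locally p_infty)
    (fun ab => 0 < fst ab < d /\ d < snd ab).
Proof.
  intros hd.
  apply Filter_prod with (fun t => 0 < t < d) (fun t => d < t).
  - now apply at_right_0_pos.
  - now exists d.
  - now intros.
Qed.

Lemma is_RInt_pos_unique (f : R -> R) (l1 l2 : R) :
  is_RInt_pos f l1 -> is_RInt_pos f l2 -> l1 = l2.
Proof.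
  intros h1 h2.
  rewrite <- (is_RInt_gen_unique f l1 h1).
  exact (is_RInt_gen_unique f l2 h2).
Qed.

Lemma is_RInt_pos_ext (f g : R -> R) (l : R) :
  (forall t, 0 < t -> f t = g t) -> is_RInt_pos f l -> is_RInt_pos g l.
Proof.
  intros h; apply is_RInt_gen_ext.
  apply filter_imp with (2 := filter_prod_pos 1 Rlt_0_1).
  intros [a b]; simpl; intros [h1 h2] t ht; apply h.
  rewrite Rmin_left in ht by lra; lra.
Qed.

Lemma is_RInt_pos_lin (f g : R -> R) (a b lf lg : R) :
  is_RInt_pos f lf -> is_RInt_pos g lg ->
  is_RInt_pos (fun t => a * f t + b * g t) (a * lf + b * lg).
Proof.
  intros hf hg.
  exact (is_RInt_gen_plus _ _ _ _ (is_RInt_gen_scal f a lf hf)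
           (is_RInt_gen_scal g b lg hg)).
Qed.

Lemma is_RInt_pos_le (f g : R -> R) (lf lg : R) :
  (forall t, 0 < t -> f t <= g t) ->
  is_RInt_pos f lf -> is_RInt_pos g lg -> lf <= lg.
Proof.
  intros h hf hg.
  assert (hd := is_RInt_pos_lin g f 1 (-1) lg lf hg hf).
  (* The nonnegative function $g-f$ dominates its own norm, so its integral dominates the norm of
     that integral and is nonnegative. *)
  assert (H : norm (1 * lg + -1 * lf) <= 1 * lg + -1 * lf).
  { refine (RInt_gen_norm _ _ _ _ _ _ hd hd);
      apply filter_imp with (2 := filter_prod_pos 1 Rlt_0_1); intros [a b]; simpl.
    - lra.
    - intros [h1 h2] t ht. specialize (h t ltac:(lra)).
      unfold norm; simpl; unfold abs; simpl; rewrite Rabs_pos_eq; lra. }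
  unfold norm in H; simpl in H; unfold abs in H; simpl in H.
  assert (h0 := Rabs_pos (1 * lg + -1 * lf)). lra.
Qed.

(** Fundamental theorem of calculus with boundary values replaced by limits; it supplies the
    integrations by parts below. *)
Lemma is_RInt_pos_derive (F f : R -> R) (l0 l1 : R) :
  (forall t, 0 < t -> is_derive F t (f t)) ->
  (forall t, 0 < t -> continuous f t) ->
  filterlim F (at_right 0) (locally l0) ->
  filterlim F (Rbar_locally p_infty) (locally l1) ->
  is_RInt_pos f (l1 - l0).
Proof.
  intros hF hf h0 h1 P hP.
  assert (hl : filterlim (fun ab => F (snd ab) - F (fst ab))
    (filter_prod (at_right 0) (Rbar_locally p_infty)) (locally (l1 - l0))).
  { assert (hb : filterlim (fun ab => F (snd ab))
      (filter_prod (at_right 0) (Rbar_locally p_infty)) (locally l1))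
      by exact (filterlim_comp _ _ _ _ _ _ _ _ filterlim_snd h1).
    assert (ha : filterlim (fun ab => F (fst ab))
      (filter_prod (at_right 0) (Rbar_locally p_infty)) (locally l0))
      by exact (filterlim_comp _ _ _ _ _ _ _ _ filterlim_fst h0).
    exact (filterlim_comp_2 _ _ Rplus hb
      (filterlim_comp _ _ _ _ _ _ _ _ ha (filterlim_opp (V := R_NormedModule) l0))
      (filterlim_plus (V := R_NormedModule) l1 (- l0))). }
  specialize (hl P hP). unfold filtermap in hl.
  unfold filtermapi.
  apply filter_imp with (2 := filter_and _ _ hl (filter_prod_pos 1 Rlt_0_1)).
  intros [a b]; simpl; intros [h [ha hb]].
  exists (F b - F a); split; [|exact h].
  apply (is_RInt_derive F f); rewrite Rmin_left, Rmax_right by lra;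
    intros t ht; [apply hF|apply hf]; lra.
Qed.

Lemma ex_RInt_pos (f : R -> R) (a b : R) :
  (forall t, 0 < t -> continuous f t) -> 0 < a -> 0 < b -> ex_RInt f a b.
Proof.
  intros hf ha hb; apply (ex_RInt_continuous f); intros t ht; apply hf.
  assert (h := Rmin_glb_lt a b 0 ha hb). lra.
Qed.

(** The endpoints may come in either order, because the Cauchy criterion compares endpoints that are
    not ordered. *)
Lemma RInt_abs_le_primitive (f g G : R -> R) (a b : R) :
  (forall t, 0 < t -> continuous f t) ->
  (forall t, 0 < t -> continuous g t) ->
  (forall t, 0 < t -> Rabs (f t) <= g t) ->
  (forall t, 0 < t -> is_derive G t (g t)) ->
  0 < a -> 0 < b -> Rabs (RInt f a b) <= Rabs (G b - G a).
Proof.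
  intros hf hg hfg hG.
  assert (H : forall a b, 0 < a -> a <= b -> Rabs (RInt f a b) <= Rabs (G b - G a)).
  { clear a b; intros a b ha hab.
    apply Rle_trans with (2 := Rle_abs _).
    apply (norm_RInt_le f g a b (RInt f a b) (G b - G a)).
    - exact hab.
    - intros t ht; apply hfg; lra.
    - apply (RInt_correct f), ex_RInt_pos; trivial; lra.
    - apply (is_RInt_derive G g); rewrite Rmin_left by lra;
        intros t ht; [apply hG|apply hg]; lra. }
  intros ha hb. destruct (Rle_lt_dec a b) as [h|h].
  - now apply H.
  - rewrite <- (opp_RInt_swap f) by now apply ex_RInt_pos.
    unfold opp; simpl. rewrite Rabs_Ropp, Rabs_minus_sym. apply H; lra.
Qed.

(** Cauchy criterion: moving the endpoints changes the integral of [f] by two end pieces, each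
    bounded by an increment of [G], and these increments are small because [G] has finite limits at
    both ends. *)
Lemma ex_RInt_pos_dominated (f g G : R -> R) (l0 l1 : R) :
  (forall t, 0 < t -> continuous f t) ->
  (forall t, 0 < t -> continuous g t) ->
  (forall t, 0 < t -> Rabs (f t) <= g t) ->
  (forall t, 0 < t -> is_derive G t (g t)) ->
  filterlim G (at_right 0) (locally l0) ->
  filterlim G (Rbar_locally p_infty) (locally l1) ->
  exists l, is_RInt_pos f l.
Proof.
  intros hf hg hfg hG h0 h1.
  destruct (proj1 (filterlim_locally_cauchy (U := R_CompleteSpace)
    (F := filter_prod (at_right 0) (Rbar_locally p_infty))
    (fun ab => RInt f (fst ab) (snd ab)))) as [l hl].
  - intros eps.
    (* Four values of [G], one per endpoint, are each compared with a limit. *)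
    assert (he : 0 < eps / 4) by (destruct eps as [e h]; simpl; lra).
    exists (fun ab => (0 < fst ab /\ 0 < snd ab) /\
       Rabs (G (fst ab) - l0) < eps / 4 /\ Rabs (G (snd ab) - l1) < eps / 4).
    split.
    + apply filter_and.
      * apply filter_imp with (2 := filter_prod_pos 1 Rlt_0_1).
        intros [a b]; simpl; lra.
      * apply Filter_prod with (fun a => Rabs (G a - l0) < eps / 4)
          (fun b => Rabs (G b - l1) < eps / 4).
        -- apply (h0 (fun y => Rabs (y - l0) < eps / 4)). exists (mkposreal _ he). now intros y hy.
        -- apply (h1 (fun y => Rabs (y - l1) < eps / 4)). exists (mkposreal _ he). now intros y hy.
        -- now intros.
    + intros [a b] [a' b']; simpl; intros [[ha hb] [hGa hGb]] [[ha' hb'] [hGa' hGb']].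
      assert (e : RInt f a' b' - RInt f a b = RInt f a' a + RInt f b b').
      { rewrite <- (RInt_Chasles f a' a b') by now apply ex_RInt_pos.
        rewrite <- (RInt_Chasles f a b b') by now apply ex_RInt_pos.
        unfold plus; simpl; lra. }
      unfold ball; simpl; unfold AbsRing_ball, abs, minus, plus, opp; simpl.
      change (Rabs (RInt f a' b' - RInt f a b) < eps).
      rewrite e.
      assert (i1 := RInt_abs_le_primitive f g G a' a hf hg hfg hG ha' ha).
      assert (i2 := RInt_abs_le_primitive f g G b b' hf hg hfg hG hb hb').
      apply Rle_lt_trans with (1 := Rabs_triang _ _).
      apply Rabs_def2 in hGa, hGb, hGa', hGb'.
      assert (Rabs (G a - G a') < eps / 2) by (apply Rabs_def1; lra).
      assert (Rabs (G b' - G b) < eps / 2) by (apply Rabs_def1; lra).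
      lra.
  - exists l. intros P hP. specialize (hl P hP). unfold filtermap in hl.
    unfold filtermapi.
    apply filter_imp with (2 := filter_and _ _ hl (filter_prod_pos 1 Rlt_0_1)).
    intros [a b]; simpl; intros [h [ha hb]].
    exists (RInt f a b); split; [|exact h].
    apply (RInt_correct f), ex_RInt_pos; trivial; lra.
Qed.

(** * Elementary inequalities *)

Lemma exp_nondecreasing (x y : R) : x <= y -> exp x <= exp y.
Proof.
  intros [h| ->]; [left; now apply exp_increasing|apply Rle_refl].
Qed.

Lemma ln_le_sub1 (s : R) : 0 < s -> ln s <= s - 1.
Proof.
  intros hs. assert (h := exp_ineq1_le (ln s)). rewrite exp_ln in h; lra.
Qed.

Lemma ln_ge_sub_inv (s : R) : 0 < s -> 1 - / s <= ln s.
Proof.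
  intros hs. assert (h := ln_le_sub1 (/ s) (Rinv_0_lt_compat _ hs)).
  rewrite ln_Rinv in h; lra.
Qed.

(** The left side is largest at $1+t=p$, and $\ln s\le s-1$ at $s=(1+t)/p$ gives that maximum.
    Exponentiated, it bounds $(1+t)^p e^{-t}$ by a constant. *)
Lemma mul_ln_sub_bounded (p : R) : 0 < p ->
  forall t, 0 < t -> p * ln (1 + t) - t <= 1 - p + p * ln p.
Proof.
  intros hp t ht.
  assert (h := ln_le_sub1 ((1 + t) / p) ltac:(apply Rdiv_lt_0_compat; lra)).
  rewrite ln_div in h by lra.
  apply (Rmult_le_compat_l p) in h; [|lra].
  replace (p * ((1 + t) / p - 1)) with (1 + t - p) in h by (field; lra). lra.
Qed.

(** Follows from $\cos u=1-2\sin^2(u/2)$ and $|\sin v|\le|v|$. *)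
Lemma one_sub_half_sqr_le_cos (u : R) : 1 - u ^ 2 / 2 <= cos u.
Proof.
  replace u with (2 * (u / 2)) at 2 by lra. rewrite cos_2a_sin.
  assert (h : Rabs (sin (u / 2)) <= Rabs (u / 2)).
  { assert (H : forall v, 0 <= v -> Rabs (sin v) <= v).
    { intros v hv. apply Rabs_le_between.
      destruct (Req_dec v 0) as [->|hv0]; [rewrite sin_0; lra|].
      assert (h1 := sin_lt_x v ltac:(lra)).
      destruct (Rle_lt_dec v PI) as [hp|hp].
      - assert (h2 := sin_ge_0 v hv hp). lra.
      - assert (h2 := SIN_bound v). assert (h3 := PI2_1). lra. }
    destruct (Rle_lt_dec 0 (u / 2)) as [h|h].
    - rewrite (Rabs_pos_eq (u / 2)) by exact h. now apply H.
    - rewrite <- (Rabs_Ropp (sin _)), <- sin_neg, <- (Rabs_Ropp (u / 2)).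
      rewrite (Rabs_pos_eq (- (u / 2))) by lra. apply H; lra. }
  apply Rsqr_le_abs_1 in h. unfold Rsqr in h. lra.
Qed.

Lemma sqr_ln_le (s : R) : 0 < s -> (ln s) ^ 2 <= s - 2 + / s.
Proof.
  intros hs.
  assert (H : forall v, 1 <= v -> 2 * ln v <= v - / v).
  { intros v hv.
    (* The difference of the two sides vanishes at 1 and its derivative is a perfect square. *)
    assert (hd : forall t, 1 <= t <= v ->
       is_derive (fun t => t - / t - 2 * ln t) t ((1 - / t) ^ 2)).
    { intros t ht. auto_derive; [lra|]. field. lra. }
    destruct (Req_dec v 1) as [->|hv1]; [rewrite ln_1; lra|].
    destruct (MVT_gen (fun t => t - / t - 2 * ln t) 1 v (fun t => (1 - / t) ^ 2)) as [c [hc e]].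
    - intros t ht. apply hd. rewrite Rmin_left, Rmax_right in ht; lra.
    - intros t ht. rewrite Rmin_left, Rmax_right in ht by lra.
      apply continuity_pt_filterlim.
      apply (ex_derive_continuous (V := R_NormedModule) (fun t => t - / t - 2 * ln t)).
      eexists. now apply hd.
    - simpl in e. rewrite ln_1 in e.
      assert (h := pow2_ge_0 (1 - / c)).
      assert (0 <= (1 - / c) ^ 2 * (v - 1)) by (apply Rmult_le_pos; lra). simpl in *; lra. }
  (* [2 ln (sqrt v) <= sqrt v - / sqrt v], squared. *)
  assert (H2 : forall v, 1 <= v -> (ln v) ^ 2 <= v - 2 + / v).
  { intros v hv.
    assert (h0 : 0 < sqrt v) by (apply sqrt_lt_R0; lra).
    assert (h1 : 1 <= sqrt v) by (rewrite <- sqrt_1; apply sqrt_le_1; lra).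
    assert (e : v = sqrt v * sqrt v) by (rewrite sqrt_sqrt; lra).
    specialize (H _ h1).
    assert (hl : 0 <= ln (sqrt v)) by (rewrite <- ln_1; apply ln_le; lra).
    rewrite e at 1. rewrite ln_mult by exact h0.
    replace (v - 2 + / v) with ((sqrt v - / sqrt v) ^ 2).
    - apply pow_incr. lra.
    - rewrite e at 3 4. field. lra. }
  (* Both sides are invariant under $s\mapsto 1/s$, which reduces $s<1$ to the case just proved. *)
  destruct (Rle_lt_dec 1 s) as [h|h]; [now apply H2|].
  assert (h1 : 1 <= / s) by (rewrite <- Rinv_1; apply Rinv_le_contravar; lra).
  specialize (H2 _ h1). rewrite ln_Rinv, Rinv_inv in H2 by lra. lra.
Qed.

(** * The integral of [t ^ (z - 1) e ^ (-t)] in real coordinates *)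

(** For $t>0$ this is $t^{x-1}e^{-t}$, kept as one exponential so that identities and bounds reduce
    to exponents. *)
Definition gamma_kernel (x t : R) : R := exp ((x - 1) * ln t - t).

Lemma gamma_kernel_succ (x t : R) : 0 < t ->
  gamma_kernel (x + 1) t = t * gamma_kernel x t.
Proof.
  intros ht; unfold gamma_kernel.
  rewrite <- (exp_ln t) at 3 by exact ht. rewrite <- exp_plus. f_equal. lra.
Qed.

Lemma filterlim_squeeze_0 (F : (R -> Prop) -> Prop) {FF : Filter F} (f g : R -> R) :
  F (fun t => Rabs (f t) <= g t) -> filterlim g F (locally 0) ->
  filterlim f F (locally 0).
Proof.
  intros h hg.
  apply (filterlim_le_le (fun t => - g t) f g 0).
  - apply filter_imp with (2 := h). intros t ht. apply Rabs_le_between in ht. lra.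
  - rewrite <- Ropp_0.
    exact (filterlim_comp _ _ _ _ _ _ _ _ hg (filterlim_opp (V := R_NormedModule) 0)).
  - exact hg.
Qed.

Lemma exp_mul_ln_lim_0 (x : R) : 0 < x ->
  filterlim (fun t => exp (x * ln t)) (at_right 0) (locally 0).
Proof.
  intros hx.
  apply (filterlim_comp _ _ _ (fun t => x * ln t) exp _ (Rbar_locally m_infty)).
  - apply (filterlim_comp _ _ _ ln (Rmult x) _ (Rbar_locally m_infty)).
    + exact is_lim_ln_0.
    (* The product of [x] and [m_infty] is defined by cases on the sign of [x]; positivity selects
       [m_infty]. *)
    + assert (h := filterlim_Rbar_mult_l x m_infty).
      simpl in h. destruct (Rle_dec 0 x) as [h1|]; [|lra].
      destruct (Rle_lt_or_eq_dec 0 x h1); [exact h|lra].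
  - exact is_lim_exp_m.
Qed.

(** The index is [x + 1] because the boundary terms of the integration by parts are of size $t^x
    e^{-t}$. *)
Lemma gamma_kernel_lim_0 (x : R) : 0 < x ->
  filterlim (gamma_kernel (x + 1)) (at_right 0) (locally 0).
Proof.
  intros hx; refine (filterlim_squeeze_0 _ _ _ _ (exp_mul_ln_lim_0 x hx)).
  apply filter_imp with (2 := at_right_0_pos 1 Rlt_0_1). intros t [ht _].
  unfold gamma_kernel. rewrite Rabs_pos_eq by (left; apply exp_pos).
  left; apply exp_increasing; lra.
Qed.

Lemma scal_inv_lim_infty (k : R) :
  filterlim (fun t => k * / t) (Rbar_locally p_infty) (locally 0).
Proof.
  replace 0 with (k * 0) by lra.
  apply (filterlim_comp _ _ _ Rinv (Rmult k) _ (locally 0)).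
  - apply (filterlim_Rbar_inv p_infty); discriminate.
  - exact (filterlim_scal_r (V := R_NormedModule) k 0).
Qed.

(** Since $t^{x+1}\le(1+t)^{x+1}$, the bound on $(1+t)^p e^{-t}$ with $p=x+1$ applies. *)
Lemma gamma_kernel_le_inv (x t : R) : 0 < x -> 0 < t ->
  exp (x * ln t - t) <= exp (1 - (x + 1) + (x + 1) * ln (x + 1)) * / t.
Proof.
  intros hx ht.
  rewrite <- (exp_ln (/ t)) by now apply Rinv_0_lt_compat.
  rewrite <- exp_plus, ln_Rinv by lra.
  assert (h := mul_ln_sub_bounded (x + 1) ltac:(lra) t ht).
  assert (hl : ln t <= ln (1 + t)) by (apply ln_le; lra).
  apply (Rmult_le_compat_l (x + 1)) in hl; [|lra].
  apply exp_nondecreasing. lra.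
Qed.

Lemma gamma_kernel_lim_infty (x : R) : 0 < x ->
  filterlim (gamma_kernel (x + 1)) (Rbar_locally p_infty) (locally 0).
Proof.
  intros hx; refine (filterlim_squeeze_0 _ _ _ _
    (scal_inv_lim_infty (exp (1 - (x + 1) + (x + 1) * ln (x + 1))))).
  exists 0. intros t ht.
  unfold gamma_kernel. rewrite Rabs_pos_eq by (left; apply exp_pos).
  replace (x + 1 - 1) with x by lra. now apply gamma_kernel_le_inv.
Qed.

(** For $t>0$ this is $(t/(1+t))^x$: an explicit primitive with finite limits at both ends for every
    $x>0$, hence suited to domination. *)
Definition beta_primitive (x t : R) : R := exp (x * (ln t - ln (1 + t))).

Lemma beta_primitive_lim_0 (x : R) : 0 < x ->
  filterlim (beta_primitive x) (at_right 0) (locally 0).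
Proof.
  intros hx.
  assert (h : filterlim (fun t => exp x * exp (x * ln t)) (at_right 0) (locally 0)).
  { replace 0 with (exp x * 0) at 2 by lra.
    exact (filterlim_comp _ _ _ _ _ _ _ _ (exp_mul_ln_lim_0 x hx)
      (filterlim_scal_r (V := R_NormedModule) (exp x) 0)). }
  refine (filterlim_squeeze_0 _ _ _ _ h).
  apply filter_imp with (2 := at_right_0_pos 1 Rlt_0_1). intros t [ht _].
  unfold beta_primitive. rewrite Rabs_pos_eq by (left; apply exp_pos).
  rewrite <- exp_plus. apply exp_nondecreasing.
  assert (hl : ln 1 <= ln (1 + t)) by (apply ln_le; lra). rewrite ln_1 in hl.
  apply (Rmult_le_compat_l x) in hl; lra.
Qed.

(** The exponent tends to 0 because $-1/t\le\ln(t/(1+t))\le 0$. *)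
Lemma beta_primitive_lim_infty (x : R) : 0 < x ->
  filterlim (beta_primitive x) (Rbar_locally p_infty) (locally 1).
Proof.
  intros hx.
  assert (h : filterlim (fun t => x * (ln t - ln (1 + t))) (Rbar_locally p_infty) (locally 0)).
  { refine (filterlim_squeeze_0 _ _ _ _ (scal_inv_lim_infty x)).
    exists 0. intros t ht.
    assert (h1 := ln_ge_sub_inv (t / (1 + t)) ltac:(apply Rdiv_lt_0_compat; lra)).
    assert (h2 : ln t <= ln (1 + t)) by (apply ln_le; lra).
    rewrite ln_div in h1 by lra.
    replace (1 - / (t / (1 + t))) with (- / t) in h1 by (field; lra).
    rewrite Rabs_mult, (Rabs_pos_eq x) by lra.
    apply Rmult_le_compat_l; [lra|]. apply Rabs_le_between; lra. }
  rewrite <- exp_0.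
  refine (filterlim_comp _ _ _ _ _ _ _ _ h _).
  apply (ElemFct.continuous_exp 0).
Qed.

(* The domination rests on [d/dt (t / (1 + t)) ^ x = x t ^ (x - 1) / (1 + t) ^ (x + 1)]. *)
Lemma ex_RInt_pos_gamma (x : R) (phi : R -> R) : 0 < x ->
  (forall t, 0 < t -> continuous phi t) -> (forall t, Rabs (phi t) <= 1) ->
  exists l, is_RInt_pos (fun t => gamma_kernel x t * phi t) l.
Proof.
  intros hx hphi hb.
  (* The exponential is the bound on $(1+t)^{x+1}e^{-t}$; dividing by [x] cancels the factor [x]
     produced by differentiating [beta_primitive]. *)
  set (K := exp (1 - (x + 1) + (x + 1) * ln (x + 1)) / x).
  assert (hk : forall t, 0 < t -> continuous (gamma_kernel x) t).
  { intros t ht. apply (ex_derive_continuous (V := R_NormedModule)).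
    unfold gamma_kernel. auto_derive; lra. }
  apply ex_RInt_pos_dominated with
    (g := fun t => K * (x / (t * (1 + t)) * beta_primitive x t))
    (G := fun t => K * beta_primitive x t) (l0 := K * 0) (l1 := K * 1).
  - intros t ht. apply (continuous_mult (K := R_AbsRing)); auto.
  - intros t ht. apply (ex_derive_continuous (V := R_NormedModule)).
    unfold beta_primitive. auto_derive. repeat split; nra.
  - intros t ht.
    rewrite Rabs_mult, (Rabs_pos_eq (gamma_kernel x t)) by (left; apply exp_pos).
    apply Rle_trans with (gamma_kernel x t * 1).
    { apply Rmult_le_compat_l; auto. left; apply exp_pos. }
    replace (K * (x / (t * (1 + t)) * beta_primitive x t)) with
      (exp (1 - (x + 1) + (x + 1) * ln (x + 1)) * (/ t * (/ (1 + t) * beta_primitive x t)))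
      by (unfold K; field; lra).
    unfold gamma_kernel, beta_primitive.
    rewrite <- (exp_ln (/ t)) by now apply Rinv_0_lt_compat.
    rewrite <- (exp_ln (/ (1 + t))) by (apply Rinv_0_lt_compat; lra).
    rewrite <- !exp_plus, !ln_Rinv, Rmult_1_r by lra.
    apply exp_nondecreasing.
    assert (h := mul_ln_sub_bounded (x + 1) ltac:(lra) t ht). lra.
  - intros t ht. unfold beta_primitive. auto_derive.
    + repeat split; lra.
    + unfold Rminus. field. lra.
  - exact (filterlim_comp _ _ _ _ _ _ _ _ (beta_primitive_lim_0 x hx)
      (filterlim_scal_r (V := R_NormedModule) K 0)).
  - exact (filterlim_comp _ _ _ _ _ _ _ _ (beta_primitive_lim_infty x hx)
      (filterlim_scal_r (V := R_NormedModule) K 1)).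
Qed.

(** With [gamma_sin], the real and imaginary parts of $t^{z-1}e^{-t}$ at $z=x+iy$. *)
Definition gamma_cos (x y t : R) : R := gamma_kernel x t * cos (y * ln t).
Definition gamma_sin (x y t : R) : R := gamma_kernel x t * sin (y * ln t).

Lemma ex_RInt_pos_gamma_cos (x y : R) : 0 < x -> exists l, is_RInt_pos (gamma_cos x y) l.
Proof.
  intros hx; apply (ex_RInt_pos_gamma x (fun t => cos (y * ln t)) hx).
  - intros t ht. apply (ex_derive_continuous (V := R_NormedModule)). auto_derive; lra.
  - intros t. apply Rabs_le_between, COS_bound.
Qed.

Lemma ex_RInt_pos_gamma_sin (x y : R) : 0 < x -> exists l, is_RInt_pos (gamma_sin x y) l.
Proof.
  intros hx; apply (ex_RInt_pos_gamma x (fun t => sin (y * ln t)) hx).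
  - intros t ht. apply (ex_derive_continuous (V := R_NormedModule)). auto_derive; lra.
  - intros t. apply Rabs_le_between, SIN_bound.
Qed.

Lemma gamma_kernel_mul_lim (F : (R -> Prop) -> Prop) {FF : Filter F} (x : R) (phi : R -> R) :
  (forall t, Rabs (phi t) <= 1) ->
  filterlim (gamma_kernel x) F (locally 0) ->
  filterlim (fun t => gamma_kernel x t * phi t) F (locally 0).
Proof.
  intros hb h. refine (filterlim_squeeze_0 _ _ _ _ h).
  apply filter_forall. intros t.
  rewrite Rabs_mult, (Rabs_pos_eq (gamma_kernel x t)) by (left; apply exp_pos).
  rewrite <- (Rmult_1_r (gamma_kernel x t)) at 2.
  apply Rmult_le_compat_l; auto. left; apply exp_pos.
Qed.

(* The integrand is the derivative of [t ^ z e ^ (-t)]. *)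
Lemma gamma_cos_succ (x y c s c' : R) : 0 < x ->
  is_RInt_pos (gamma_cos x y) c -> is_RInt_pos (gamma_sin x y) s ->
  is_RInt_pos (gamma_cos (x + 1) y) c' -> c' = x * c - y * s.
Proof.
  intros hx hc hs hc'.
  assert (h0 := is_RInt_pos_lin _ _ 1 (-1) _ _ (is_RInt_pos_lin _ _ x (- y) _ _ hc hs) hc').
  assert (h1 : is_RInt_pos (fun t => 1 * (x * gamma_cos x y t + - y * gamma_sin x y t)
     + -1 * gamma_cos (x + 1) y t) (0 - 0)).
  { apply is_RInt_pos_derive with (F := fun t => gamma_kernel (x + 1) t * cos (y * ln t)).
    - intros t ht. unfold gamma_cos, gamma_sin. rewrite gamma_kernel_succ by exact ht.
      apply is_derive_ext_loc with (fun t => t * gamma_kernel x t * cos (y * ln t)).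
      (* The rewriting of the kernel holds at positive arguments, and the ball of radius [t] about
         [t] contains only such. *)
      + exists (mkposreal t ht). intros u hu.
        unfold ball in hu; simpl in hu;
          unfold AbsRing_ball, abs, minus, plus, opp in hu; simpl in hu.
        apply Rabs_def2 in hu. rewrite gamma_kernel_succ; lra.
      + unfold gamma_kernel, Rminus. auto_derive; [lra|]. field. lra.
    - intros t ht. apply (ex_derive_continuous (V := R_NormedModule)).
      unfold gamma_cos, gamma_sin, gamma_kernel. auto_derive. lra.
    - apply gamma_kernel_mul_lim; [typeclasses eauto| |now apply gamma_kernel_lim_0].
      intros t. apply Rabs_le_between, COS_bound.
    - apply gamma_kernel_mul_lim; [typeclasses eauto| |now apply gamma_kernel_lim_infty].
      intros t. apply Rabs_le_between, COS_bound. }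
  assert (e := is_RInt_pos_unique _ _ _ h0 h1). lra.
Qed.

(** Imaginary part of $\Gamma(z+1)=z\Gamma(z)$, by the same integration by parts as for the real
    part. *)
Lemma gamma_sin_succ (x y c s s' : R) : 0 < x ->
  is_RInt_pos (gamma_cos x y) c -> is_RInt_pos (gamma_sin x y) s ->
  is_RInt_pos (gamma_sin (x + 1) y) s' -> s' = x * s + y * c.
Proof.
  intros hx hc hs hs'.
  assert (h0 := is_RInt_pos_lin _ _ 1 (-1) _ _ (is_RInt_pos_lin _ _ x y _ _ hs hc) hs').
  assert (h1 : is_RInt_pos (fun t => 1 * (x * gamma_sin x y t + y * gamma_cos x y t)
     + -1 * gamma_sin (x + 1) y t) (0 - 0)).
  { apply is_RInt_pos_derive with (F := fun t => gamma_kernel (x + 1) t * sin (y * ln t)).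
    - intros t ht. unfold gamma_cos, gamma_sin. rewrite gamma_kernel_succ by exact ht.
      apply is_derive_ext_loc with (fun t => t * gamma_kernel x t * sin (y * ln t)).
      + exists (mkposreal t ht). intros u hu.
        unfold ball in hu; simpl in hu;
          unfold AbsRing_ball, abs, minus, plus, opp in hu; simpl in hu.
        apply Rabs_def2 in hu. rewrite gamma_kernel_succ; lra.
      + unfold gamma_kernel, Rminus. auto_derive; [lra|]. field. lra.
    - intros t ht. apply (ex_derive_continuous (V := R_NormedModule)).
      unfold gamma_cos, gamma_sin, gamma_kernel. auto_derive. lra.
    - apply gamma_kernel_mul_lim; [typeclasses eauto| |now apply gamma_kernel_lim_0].
      intros t. apply Rabs_le_between, SIN_bound.
    - apply gamma_kernel_mul_lim; [typeclasses eauto| |now apply gamma_kernel_lim_infty].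
      intros t. apply Rabs_le_between, SIN_bound. }
  assert (e := is_RInt_pos_unique _ _ _ h0 h1). lra.
Qed.

(** * Real Gamma integrals and their positivity *)

Lemma is_RInt_pos_gamma_kernel_1 : is_RInt_pos (gamma_kernel 1) 1.
Proof.
  replace 1 with (0 - (-1)) at 2 by lra.
  apply is_RInt_pos_ext with (fun t => exp (- t)).
  { intros t _. unfold gamma_kernel. f_equal. lra. }
  apply is_RInt_pos_derive with (F := fun t => - exp (- t)).
  - intros t _. auto_derive; [trivial|]. lra.
  - intros t _. apply (ex_derive_continuous (V := R_NormedModule)). auto_derive; trivial.
  - apply (filterlim_filter_le_1 (F := locally 0) (G := at_right 0) (H := locally (-1))
      (fun t => - exp (- t))).
    + apply filter_le_within.
    + replace (-1) with (- exp (- 0)) by (rewrite Ropp_0, exp_0; lra).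
      apply (ex_derive_continuous (V := R_NormedModule) (fun t => - exp (- t)) 0).
      auto_derive; trivial.
  - rewrite <- Ropp_0.
    refine (filterlim_comp _ _ _ (fun t => exp (- t)) _ _ _ _ _
      (filterlim_opp (V := R_NormedModule) 0)).
    apply (filterlim_comp _ _ _ Ropp exp _ (Rbar_locally m_infty)).
    + exact (filterlim_Rbar_opp p_infty).
    + exact is_lim_exp_m.
Qed.

Lemma gamma_kernel_succ_int (x g g' : R) : 0 < x ->
  is_RInt_pos (gamma_kernel x) g -> is_RInt_pos (gamma_kernel (x + 1)) g' -> g' = x * g.
Proof.
  intros hx hg hg'.
  assert (hz : forall x g, is_RInt_pos (gamma_kernel x) g -> is_RInt_pos (gamma_cos x 0) g).
  { intros u v. apply is_RInt_pos_ext. intros t _. unfold gamma_cos.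
    rewrite Rmult_0_l, cos_0. lra. }
  destruct (ex_RInt_pos_gamma_sin x 0 hx) as [s hs].
  rewrite (gamma_cos_succ x 0 g s g' hx (hz _ _ hg) hs (hz _ _ hg')). lra.
Qed.

Lemma ex_RInt_pos_gamma_kernel (x : R) : 0 < x -> exists g, is_RInt_pos (gamma_kernel x) g.
Proof.
  intros hx. destruct (ex_RInt_pos_gamma_cos x 0 hx) as [g hg]. exists g.
  apply is_RInt_pos_ext with (2 := hg). intros t _. unfold gamma_cos.
  rewrite Rmult_0_l, cos_0. lra.
Qed.

(* Compares [t ^ (x - 1)] with [t (1 + (x - 2) (1 - 1 / t))]. *)
Lemma gamma_kernel_int_ge_1 (x g : R) : 2 <= x -> is_RInt_pos (gamma_kernel x) g -> 1 <= g.
Proof.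
  intros hx hg.
  destruct (ex_RInt_pos_gamma_kernel (1 + 1) ltac:(lra)) as [g2 hg2].
  assert (e := gamma_kernel_succ_int 1 1 g2 Rlt_0_1 is_RInt_pos_gamma_kernel_1 hg2).
  (* The minorant is $(x-1)te^{-t}-(x-2)e^{-t}$; as $\Gamma(2)=\Gamma(1)=1$, its integral is 1. *)
  assert (h := is_RInt_pos_lin _ _ (x - 1) (- (x - 2)) _ _ hg2 is_RInt_pos_gamma_kernel_1).
  apply Rle_trans with ((x - 1) * g2 + - (x - 2) * 1); [rewrite e; lra|].
  apply is_RInt_pos_le with (2 := h) (3 := hg).
  intros t ht. rewrite gamma_kernel_succ by exact ht.
  unfold gamma_kernel.
  replace ((1 - 1) * ln t - t) with (- t) by lra.
  replace ((x - 1) * ln t - t) with (ln t + (x - 2) * ln t + - t) by lra.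
  rewrite !exp_plus, exp_ln by exact ht.
  assert (h1 := exp_ineq1_le ((x - 2) * ln t)).
  assert (h2 := Rmult_le_compat_l (x - 2) _ _ ltac:(lra) (ln_ge_sub_inv t ht)).
  assert (h3 : t * (1 + (x - 2) * (1 - / t)) <= t * exp ((x - 2) * ln t))
    by (apply Rmult_le_compat_l; lra).
  replace (t * (1 + (x - 2) * (1 - / t))) with ((x - 1) * t - (x - 2)) in h3 by (field; lra).
  apply (Rmult_le_compat_r (exp (- t))) in h3; [|left; apply exp_pos]. lra.
Qed.

(* The mass of [t ^ (x - 1) e ^ (-t)] concentrates at [t = x], so that for large [x]
   the rotation by [- y ln x] makes the real part of the integral positive. *)
Lemma gamma_rotated_pos (x y c s : R) : 3 <= x -> y ^ 2 < 2 * (x - 1) ->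
  is_RInt_pos (gamma_cos x y) c -> is_RInt_pos (gamma_sin x y) s ->
  0 < cos (y * ln x) * c + sin (y * ln x) * s.
Proof.
  intros hx hy hc hs.
  destruct (ex_RInt_pos_gamma_kernel x ltac:(lra)) as [g hg].
  destruct (ex_RInt_pos_gamma_kernel (x + 1) ltac:(lra)) as [g1 hg1].
  destruct (ex_RInt_pos_gamma_kernel (x - 1) ltac:(lra)) as [g0 hg0].
  assert (e1 := gamma_kernel_succ_int x g g1 ltac:(lra) hg hg1).
  assert (hg' := hg). replace x with (x - 1 + 1) in hg' by lra.
  assert (e0 := gamma_kernel_succ_int (x - 1) g0 g ltac:(lra) hg0 hg').
  assert (h1 := gamma_kernel_int_ge_1 x g ltac:(lra) hg).
  (* The minorant is the kernel times $1-\frac{y^2}{2}(t/x-2+x/t)$; the factors $t/x$ and $x/t$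
     shift the kernel to the indices [x + 1] and [x - 1]. *)
  assert (hl := is_RInt_pos_lin _ _ 1 (- (y ^ 2 / (2 * x))) _ _
     (is_RInt_pos_lin _ _ (1 + y ^ 2) (- (y ^ 2 * x / 2)) _ _ hg hg0) hg1).
  assert (hr := is_RInt_pos_lin _ _ (cos (y * ln x)) (sin (y * ln x)) _ _ hc hs).
  apply Rlt_le_trans with
    (1 * ((1 + y ^ 2) * g + - (y ^ 2 * x / 2) * g0) + - (y ^ 2 / (2 * x)) * g1).
  - replace (1 * ((1 + y ^ 2) * g + - (y ^ 2 * x / 2) * g0) + - (y ^ 2 / (2 * x)) * g1)
      with (g0 * (x - 1 - y ^ 2 / 2)) by (rewrite e1, e0; field; lra).
    apply Rmult_lt_0_compat; [|lra].
    (* Positivity of [g0] comes from $(x-1)g_0=g\ge 1$. *)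
    destruct (Rlt_or_le 0 g0) as [h|h]; [exact h|].
    assert ((x - 1) * g0 <= 0) by nra. lra.
  - apply is_RInt_pos_le with (2 := hl) (3 := hr). intros t ht.
    unfold gamma_cos, gamma_sin. rewrite gamma_kernel_succ by exact ht.
    replace (gamma_kernel x t) with (t * gamma_kernel (x - 1) t)
      by (rewrite <- gamma_kernel_succ by exact ht; f_equal; lra).
    set (k := gamma_kernel (x - 1) t).
    assert (hk : 0 < k) by apply exp_pos.
    assert (hcos : cos (y * ln x) * cos (y * ln t) + sin (y * ln x) * sin (y * ln t)
       = cos (y * ln (t / x))).
    { rewrite ln_div by lra. rewrite Rmult_minus_distr_l, cos_minus. lra. }
    assert (h2 := one_sub_half_sqr_le_cos (y * ln (t / x))).
    assert (h3 := sqr_ln_le (t / x) ltac:(apply Rdiv_lt_0_compat; lra)).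
    rewrite <- hcos, Rpow_mult_distr in h2.
    apply (Rmult_le_compat_l (y ^ 2)) in h3; [|apply pow2_ge_0].
    assert (h4 : 1 - y ^ 2 * (t / x - 2 + / (t / x)) / 2 <=
      cos (y * ln x) * cos (y * ln t) + sin (y * ln x) * sin (y * ln t)) by lra.
    apply (Rmult_le_compat_l (t * k)) in h4; [|nra].
    replace (t * k * (1 - y ^ 2 * (t / x - 2 + / (t / x)) / 2)) with
      (1 * ((1 + y ^ 2) * (t * k) + - (y ^ 2 * x / 2) * k) + - (y ^ 2 / (2 * x)) * (t * (t * k)))
      in h4 by (field; lra).
    lra.
Qed.

Local Open Scope C_scope.

(** * Finite products *)

Lemma Cprod_ext (f g : nat -> C) (lo hi : nat) :
  (forall i, (lo <= i <= hi)%nat -> f i = g i) -> Cprod f lo hi = Cprod g lo hi.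
Proof. apply Iter.iter_nat_ext_loc. Qed.

Lemma Cprod_S (f : nat -> C) (n : nat) : Cprod f 1 (S n) = Cprod f 1 n * f (S n).
Proof.
  unfold Cprod.
  rewrite (Iter.iter_nat_Chasles Cmult (RtoC 1)) with (m := n); try lia.
  - now rewrite Iter.iter_nat_point by apply Cmult_1_r.
  - apply Cmult_1_l.
  - apply Cmult_assoc.
Qed.

(** Serves to detach the factor $j=1$ and reindex the others, turning $a_1,\dots,a_{n+1}$ into
    $a_2,\dots,a_{n+1}$. *)
Lemma Cprod_S_l (f : nat -> C) (n : nat) :
  Cprod f 1 (S n) = f 1%nat * Cprod (fun i => f (i + 1)%nat) 1 n.
Proof.
  induction n as [|n IH].
  - rewrite Cprod_S. unfold Cprod, Iter.iter_nat; simpl. ring.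
  - rewrite Cprod_S, IH, Cprod_S, Nat.add_1_r. ring.
Qed.

Lemma Cprod_mult (f g : nat -> C) (n : nat) :
  Cprod (fun i => f i * g i) 1 n = Cprod f 1 n * Cprod g 1 n.
Proof.
  induction n as [|n IH].
  - unfold Cprod, Iter.iter_nat; simpl. ring.
  - rewrite !Cprod_S, IH. ring.
Qed.

Lemma Cprod_neq_0 (f : nat -> C) (n : nat) :
  (forall i, (1 <= i <= n)%nat -> f i <> 0) -> Cprod f 1 n <> 0.
Proof.
  intros h. induction n as [|n IH].
  - exact C1_nz.
  - rewrite Cprod_S. apply Cmult_neq_0; [apply IH; intros|]; apply h; lia.
Qed.

Lemma Cprod_1 (f : nat -> C) (n : nat) :
  (forall i, (1 <= i <= n)%nat -> f i = 1) -> Cprod f 1 n = 1.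
Proof.
  intros h. induction n as [|n IH]; [reflexivity|].
  rewrite Cprod_S, IH, h by (intros; apply h || lia; lia). ring.
Qed.

(** * The complex Gamma function *)

(** Bridge from the two real integrals to [Gamma_integral]: balls in the real structure on [C] are
    products of intervals, so convergence is componentwise. *)
Lemma is_RInt_gen_pair (f g : R -> R) (lf lg : R) :
  is_RInt_pos f lf -> is_RInt_pos g lg ->
  is_RInt_gen (V := C_R_NormedModule) (fun t => (f t, g t))
    (at_right 0) (Rbar_locally p_infty) (lf, lg).
Proof.
  intros hf hg P [eps hP].
  assert (h1 := hf (ball lf eps) (locally_ball lf eps)).
  assert (h2 := hg (ball lg eps) (locally_ball lg eps)).
  unfold filtermapi in *.
  apply filter_imp with (2 := filter_and _ _ h1 h2).
  intros [a b]; simpl; intros [[u [hu bu]] [v [hv bv]]].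
  exists (u, v); split.
  - exact (is_RInt_fct_extend_pair (U := R_NormedModule) (V := R_NormedModule)
      (fun t => (f t, g t)) a b u v hu hv).
  - apply hP. split; assumption.
Qed.

Lemma Gamma_integral_eq (z : C) (c s : R) :
  is_RInt_pos (gamma_cos (Re z) (Im z)) c -> is_RInt_pos (gamma_sin (Re z) (Im z)) s ->
  Gamma_integral z = (c, s).
Proof.
  intros hc hs. unfold Gamma_integral.
  apply (is_RInt_gen_unique (V := C_R_CompleteNormedModule)).
  refine (is_RInt_gen_ext (V := C_R_NormedModule) _ _ _ _ (is_RInt_gen_pair _ _ _ _ hc hs)).
  apply filter_forall. intros [a b] t _.
  destruct z as [x y]. unfold gamma_cos, gamma_sin, gamma_kernel, Cexp.
  replace (exp ((Re (x, y) - 1) * ln t - t)) with (exp ((x - 1) * ln t) * exp (- t))%R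
    by (rewrite <- exp_plus; f_equal; simpl; ring).
  unfold Cmult, Cminus, Cplus, Copp, RtoC; simpl.
  replace ((x + - (1)) * ln t - (y + - 0) * 0)%R with ((x - 1) * ln t)%R by ring.
  replace ((x + - (1)) * 0 + (y + - 0) * ln t)%R with (y * ln t)%R by ring.
  f_equal; ring.
Qed.

Lemma Gamma_integral_succ (z : C) : (0 < Re z)%R ->
  Gamma_integral (z + 1) = z * Gamma_integral z.
Proof.
  intros hz.
  destruct (ex_RInt_pos_gamma_cos (Re z) (Im z) hz) as [c hc].
  destruct (ex_RInt_pos_gamma_sin (Re z) (Im z) hz) as [s hs].
  destruct (ex_RInt_pos_gamma_cos (Re z + 1) (Im z) ltac:(lra)) as [c' hc'].
  destruct (ex_RInt_pos_gamma_sin (Re z + 1) (Im z) ltac:(lra)) as [s' hs'].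
  rewrite (Gamma_integral_eq z c s hc hs).
  rewrite (Gamma_integral_eq (z + 1) c' s').
  - rewrite (gamma_cos_succ _ _ _ _ _ hz hc hs hc').
    rewrite (gamma_sin_succ _ _ _ _ _ hz hc hs hs').
    destruct z as [x y]. unfold Cmult; simpl. f_equal; ring.
  - destruct z as [x y]; simpl in *. now rewrite Rplus_0_r.
  - destruct z as [x y]; simpl in *. now rewrite Rplus_0_r.
Qed.

Lemma Re_plus_INR (z : C) (m : nat) : Re (z + RtoC (INR m)) = (Re z + INR m)%R.
Proof. now destruct z. Qed.

Lemma RtoC_INR_S (m : nat) : RtoC (INR (S m)) = RtoC (INR m) + 1.
Proof. now rewrite S_INR, RtoC_plus. Qed.

Lemma Gamma_integral_zero_shift (z : C) (m : nat) : (0 < Re z)%R ->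
  Gamma_integral z = 0 -> Gamma_integral (z + RtoC (INR m)) = 0.
Proof.
  intros hz h0. induction m as [|m IH].
  - simpl. now rewrite Cplus_0_r.
  - rewrite RtoC_INR_S, Cplus_assoc, Gamma_integral_succ, IH; [ring|].
    rewrite Re_plus_INR. assert (h := pos_INR m). lra.
Qed.

Lemma Gamma_integral_neq_0 (z : C) : (0 < Re z)%R -> Gamma_integral z <> 0.
Proof.
  intros hz h0.
  (* This shift gives both $\mathrm{Re}\,w\ge 3$ and $(\mathrm{Im}\,w)^2<2(\mathrm{Re}\,w-1)$, as
     [gamma_rotated_pos] requires. *)
  destruct (INR_unbounded (3 + Im z ^ 2)) as [m hm].
  assert (hp := pow2_ge_0 (Im z)).
  assert (e := Gamma_integral_zero_shift z m hz h0).
  assert (hre := Re_plus_INR z m).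
  assert (him : Im (z + RtoC (INR m)) = Im z) by (destruct z; simpl; ring).
  set (w := z + RtoC (INR m)) in *.
  destruct (ex_RInt_pos_gamma_cos (Re w) (Im w) ltac:(lra)) as [c hc].
  destruct (ex_RInt_pos_gamma_sin (Re w) (Im w) ltac:(lra)) as [s hs].
  assert (h := gamma_rotated_pos (Re w) (Im w) c s ltac:(lra)
    ltac:(rewrite him; lra) hc hs).
  rewrite (Gamma_integral_eq w c s hc hs) in e.
  injection e as -> ->. lra.
Qed.

Lemma Gamma_integral_1 : Gamma_integral 1 = 1.
Proof.
  apply Gamma_integral_eq.
  - apply is_RInt_pos_ext with (2 := is_RInt_pos_gamma_kernel_1).
    intros t _. unfold gamma_cos; simpl. rewrite Rmult_0_l, cos_0. ring.
  - assert (h := is_RInt_pos_lin _ _ 0 0 _ _ is_RInt_pos_gamma_kernel_1 is_RInt_pos_gamma_kernel_1).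
    replace (0 * 1 + 0 * 1)%R with 0%R in h by ring.
    apply is_RInt_pos_ext with (2 := h).
    intros t _. unfold gamma_sin; simpl. rewrite (Rmult_0_l (ln t)), sin_0. ring.
Qed.

(** * Shifts into the right half-plane and the reciprocal Gamma function *)

Lemma Gamma_shift_pos (z : C) : (0 < Re (z + RtoC (INR (Gamma_shift z))))%R.
Proof.
  rewrite Re_plus_INR. unfold Gamma_shift.
  destruct (archimed (- Re z)) as [h1 h2].
  destruct (Z.le_gt_cases 0 (up (- Re z))) as [h|h].
  - rewrite INR_IZR_INZ, Z2Nat.id by exact h. lra.
  - assert (h3 : (IZR (up (- Re z)) <= 0)%R) by (apply IZR_le; lia).
    assert (h4 := pos_INR (Z.to_nat (up (- Re z)))). lra.
Qed.

Lemma Gamma_shift_0 (z : C) : (0 < Re z)%R -> Gamma_shift z = 0%nat.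
Proof.
  intros hz. unfold Gamma_shift.
  destruct (archimed (- Re z)) as [h1 h2].
  assert (h : (up (- Re z) < 1)%Z) by (apply lt_IZR; lra). lia.
Qed.

(** Both functions use the same shift, so they are inverse quotients once numerator and denominator
    are nonzero: a factor $z+i-1$ of [Crising] vanishes only at the pole $-(i-1)$. *)
Lemma Gamma_mult_RGamma (z : C) :
  (forall m : nat, z <> RtoC (- INR m)) -> Gamma z * RGamma z = 1.
Proof.
  intros h. unfold Gamma, RGamma. set (m := Gamma_shift z).
  assert (h1 := Gamma_integral_neq_0 _ (Gamma_shift_pos z)). fold m in h1.
  assert (h2 : Crising z m <> 0).
  { apply Cprod_neq_0. intros i hi e. apply (h (i - 1)%nat).
    rewrite RtoC_opp, minus_INR, RtoC_minus by lia. simpl INR.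
    replace z with (z + RtoC (INR i) - 1 - (RtoC (INR i) - 1)) by ring.
    rewrite e. ring. }
  field. split; assumption.
Qed.

Lemma RGamma_pos (z : C) : (0 < Re z)%R -> RGamma z = / Gamma_integral z.
Proof.
  intros hz. unfold RGamma. rewrite Gamma_shift_0 by exact hz.
  simpl INR. rewrite Cplus_0_r. unfold Crising, Cprod, Iter.iter_nat; simpl.
  apply Cmult_1_l.
Qed.

Lemma RGamma_fact (k : nat) : RGamma (RtoC (INR k) + 1) = / RtoC (INR (fact k)).
Proof.
  assert (hk : forall k, (0 < Re (RtoC (INR k) + 1))%R).
  { intros i. assert (h := pos_INR i). simpl. lra. }
  rewrite RGamma_pos by apply hk. f_equal.
  induction k as [|k IH].
  - simpl INR. rewrite Cplus_0_l. apply Gamma_integral_1.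
  - rewrite RtoC_INR_S, Gamma_integral_succ by apply hk.
    rewrite IH, fact_simpl, mult_INR, RtoC_mult, RtoC_INR_S. reflexivity.
Qed.

(* Beyond [Re w >= 1], [RGamma (w + 1) = RGamma w / w] does not increase in modulus. *)
Lemma RGamma_translates_bounded (w : C) :
  exists M : R, forall k : nat, (Cmod (RGamma (RtoC (INR k) + w)) <= M)%R.
Proof.
  set (u := fun k : nat => Cmod (RGamma (RtoC (INR k) + w))).
  (* From [K] on, the real part of $k+w$ exceeds 1; the finitely many earlier values are bounded by
     their maximum. *)
  destruct (INR_unbounded (1 - Re w)) as [K hK].
  assert (hK' : exists M, forall k, (k <= K)%nat -> (u k <= M)%R).
  { clear hK. induction K as [|K [M IH]].
    - exists (u 0%nat). intros k hk. replace k with 0%nat by lia. lra.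
    - exists (Rmax M (u (S K))). intros k hk.
      destruct (Nat.eq_dec k (S K)) as [->|hk'].
      + apply Rmax_r.
      + apply Rle_trans with (2 := Rmax_l _ _). apply IH. lia. }
  destruct hK' as [M hM]. exists M. intros k. change (u k <= M)%R.
  induction k as [|k IH]; [apply hM; lia|].
  destruct (Nat.le_gt_cases (S k) K) as [h|h]; [now apply hM|].
  apply Rle_trans with (2 := IH). unfold u.
  assert (hkK : (INR K <= INR k)%R) by (apply le_INR; lia).
  rewrite RtoC_INR_S.
  replace (RtoC (INR k) + 1 + w) with (RtoC (INR k) + w + 1) by ring.
  set (v := RtoC (INR k) + w).
  assert (hv : (1 < Re v)%R) by (unfold v; rewrite Cplus_comm, Re_plus_INR; lra).
  rewrite !RGamma_pos by (destruct v; simpl in *; lra).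
  rewrite Gamma_integral_succ by lra.
  assert (h1 : (1 <= Cmod v)%R).
  { apply Rle_trans with (2 := re_le_Cmod v). apply Rle_trans with (2 := Rle_abs _). lra. }
  assert (hg := Gamma_integral_neq_0 v ltac:(lra)).
  assert (hv0 : v <> 0) by (intros e; rewrite e, Cmod_0 in h1; lra).
  rewrite (Cmod_inv _ hg), (Cmod_inv _ (Cmult_neq_0 _ _ hv0 hg)), Cmod_mult.
  apply Cmod_gt_0 in hg.
  apply Rinv_le_contravar; [exact hg|].
  rewrite <- (Rmult_1_l (Cmod (Gamma_integral v))) at 1.
  apply Rmult_le_compat_r; lra.
Qed.

(** * The two series *)

Lemma Cprod_RGamma_bounded (d : nat) (mu : nat -> C) :
  exists M : R, forall k : nat,
    (Cmod (Cprod (fun j => RGamma (RtoC (INR k) + mu j + 1)) 1 d) <= M)%R.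
Proof.
  induction d as [|d [M IH]].
  - exists 1%R. intros k. unfold Cprod, Iter.iter_nat; simpl. rewrite Cmod_1. lra.
  - destruct (RGamma_translates_bounded (mu (S d) + 1)) as [M' hM'].
    exists (M * M')%R. intros k. rewrite Cprod_S, Cmod_mult.
    apply Rmult_le_compat; try apply Cmod_ge_0; [apply IH|].
    rewrite <- Cplus_assoc. apply hM'.
Qed.

Lemma ex_series_hyper_Bessel (d : nat) (mu : nat -> C) (z : C) :
  @ex_series C_AbsRing C_NormedModule (hyper_Bessel_term d mu z).
Proof.
  destruct (Cprod_RGamma_bounded d mu) as [M hM].
  apply (ex_series_le (K := C_AbsRing) (V := C_CompleteNormedModule)
    (hyper_Bessel_term d mu z) (fun k => M * (Cmod z ^ k * / INR (fact k)))%R).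
  - intros k. change (Cmod (hyper_Bessel_term d mu z k) <= M * (Cmod z ^ k * / INR (fact k)))%R.
    unfold hyper_Bessel_term, Cdiv.
    assert (hf := INR_fact_lt_0 k).
    assert (hf0 : RtoC (INR (fact k)) <> 0) by (intros e; injection e; lra).
    rewrite !Cmod_mult, (Cmod_inv _ hf0), !Cmod_pow, !Cmod_R, (Rabs_pos_eq (INR _)) by lra.
    replace (Rabs (-1)) with 1%R by (rewrite Rabs_left; lra).
    rewrite pow1, Rmult_1_l, Rmult_comm.
    apply Rmult_le_compat_r; [|apply hM].
    apply Rmult_le_pos; [apply pow_le, Cmod_ge_0|].
    left; now apply Rinv_0_lt_compat.
  - apply (ex_series_scal (K := R_AbsRing) (V := R_NormedModule)).
    eexists. apply is_series_ext with (2 := is_exp_Reals (Cmod z)).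
    intros k. rewrite pow_n_pow. reflexivity.
Qed.

Lemma CSeries_unique (u : nat -> C) (l : C) :
  @is_series C_AbsRing C_NormedModule u l -> CSeries u = l.
Proof.
  intros h. apply (iota_unique (V := C_CompleteNormedModule)); [|exact h].
  intros y hy.
  exact (filterlim_locally_unique (V := C_NormedModule) _ _ _ hy h).
Qed.

(** The $\nu$ terms agree, and the difference telescopes to $\alpha_j-\alpha_0$ with
    $\alpha_0=0$. *)
Lemma b_par_eq (alpha : nat -> R) (nu : nat -> C) (j : nat) : (1 <= j)%nat ->
  b_par alpha nu j = a_par alpha nu j + RtoC (alpha j).
Proof.
  intros hj. unfold a_par, b_par.
  induction hj as [|j hj IH].
  - rewrite !sum_n_n. simpl. ring.
  - rewrite !sum_n_Sm by lia.
    unfold plus; simpl. simpl in IH.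
    replace (j - 0)%nat with j by lia.
    rewrite !Cplus_assoc, IH. destruct j as [|j]; [lia|]. simpl. ring.
Qed.

Lemma a_par_1 (alpha : nat -> R) (nu : nat -> C) :
  alpha 1%nat = 1%R -> a_par alpha nu 1 = 0.
Proof.
  intros h. unfold a_par. rewrite sum_n_n. simpl. rewrite h. ring.
Qed.

Lemma Cprod_Gamma_telescope (n : nat) (a : nat -> C)
  (ha : forall j : nat, (1 <= j <= n)%nat ->
        forall m : nat, (1 <= m)%nat -> a j <> RtoC (- INR m)) (k : nat) :
  Cprod (fun i => Cprod (fun j =>
    Gamma (RtoC (INR i) + a j) * RGamma (RtoC (INR i) + a j + 1)) 1 n) 1 k =
  Cprod (fun j => Gamma (1 + a j)) 1 n *
  Cprod (fun j => RGamma (RtoC (INR k) + a j + 1)) 1 n.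
Proof.
  (* A pole $i+a_j+1=-m$ would mean $a_j=-(m+i+1)$, a negative integer; $a_j=0$ stays allowed
     because [i] starts at 0 and 1 is added. *)
  assert (hGR : forall i j, (1 <= j <= n)%nat ->
    Gamma (RtoC (INR i) + a j + 1) * RGamma (RtoC (INR i) + a j + 1) = 1).
  { intros i j hj. apply Gamma_mult_RGamma. intros m e.
    apply (ha j hj (m + S i)%nat); [lia|].
    rewrite plus_INR, RtoC_opp, RtoC_plus, RtoC_INR_S.
    rewrite RtoC_opp in e.
    replace (a j) with (RtoC (INR i) + a j + 1 - RtoC (INR i) - 1) by ring.
    rewrite e. ring. }
  induction k as [|k IH].
  - rewrite <- Cprod_mult.
    transitivity (RtoC 1); [reflexivity|symmetry; apply Cprod_1].
    intros j hj. replace (1 + a j) with (RtoC (INR 0) + a j + 1) by (simpl INR; ring).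
    now apply hGR.
  - rewrite Cprod_S, IH, Cprod_mult.
    rewrite (Cprod_ext (fun j => Gamma (RtoC (INR (S k)) + a j))
      (fun j => Gamma (RtoC (INR k) + a j + 1)))
      by (intros j _; rewrite RtoC_INR_S; f_equal; ring).
    (* The factors $1/\Gamma(k+a_j+1)$ from the induction hypothesis meet the new numerators
       $\Gamma(k+1+a_j)$ and cancel. *)
    rewrite Cmult_assoc, <- (Cmult_assoc (Cprod (fun j => Gamma (1 + a j)) 1 n)).
    rewrite <- Cprod_mult.
    rewrite (Cprod_1 (fun j =>
        RGamma (RtoC (INR k) + a j + 1) * Gamma (RtoC (INR k) + a j + 1)))
      by (intros j hj; rewrite Cmult_comm; now apply hGR).
    ring.
Qed.

Lemma W_term_eq (n : nat) (hn : (1 <= n)%nat)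
  (alpha : nat -> R) (nu : nat -> C)
  (halpha : forall j : nat, (1 <= j <= n + 1)%nat -> alpha j = 1%R)
  (ha : forall j : nat, (1 <= j <= n)%nat ->
        forall m : nat, (1 <= m)%nat -> a_par alpha nu j <> RtoC (- INR m))
  (z : C) (k : nat) :
  W_term n alpha nu z k =
    Cprod (fun j => Gamma (1 + a_par alpha nu j)) 1 n *
    hyper_Bessel_term n (fun j => a_par alpha nu (j + 1)) (- z) k.
Proof.
  assert (hb : forall i j, (1 <= j <= n + 1)%nat ->
    RtoC (alpha (n + 1)%nat * INR i) + b_par alpha nu j = RtoC (INR i) + a_par alpha nu j + 1).
  { intros i j hj. rewrite b_par_eq, !halpha, Rmult_1_l by lia. ring. }
  unfold W_term, hyper_Bessel_term.
  rewrite (Cprod_ext _ (fun i => Cprod (fun j => Gamma (RtoC (INR i) + a_par alpha nu j) *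
      RGamma (RtoC (INR i) + a_par alpha nu j + 1)) 1 n)).
  2:{ intros i _. apply Cprod_ext. intros j hj. rewrite hb by lia.
      rewrite halpha, Rmult_1_l by lia. reflexivity. }
  rewrite Cprod_Gamma_telescope by exact ha.
  rewrite hb by lia.
  (* Both sides are the product of $1/\Gamma(k+a_j+1)$ over $j=1,\dots,n+1$: the left detaches
     $j=n+1$, the right $j=1$, where $a_1=0$ yields $1/k!$. *)
  assert (hs : Cprod (fun j => RGamma (RtoC (INR k) + a_par alpha nu j + 1)) 1 n *
      RGamma (RtoC (INR k) + a_par alpha nu (n + 1) + 1) =
    / RtoC (INR (fact k)) *
      Cprod (fun j => RGamma (RtoC (INR k) + a_par alpha nu (j + 1) + 1)) 1 n).
  { rewrite Nat.add_1_r.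
    rewrite <- (Cprod_S (fun j => RGamma (RtoC (INR k) + a_par alpha nu j + 1))), Cprod_S_l.
    rewrite a_par_1, Cplus_0_r, RGamma_fact by (apply halpha; lia). reflexivity. }
  rewrite <- Cpow_mult_l. replace (RtoC (-1) * - z) with z by
    (change (RtoC (-1)) with (RtoC (Ropp 1)); rewrite RtoC_opp; ring).
  unfold Cdiv. rewrite <- (Cmult_assoc (z ^ k)), <- hs. ring.
Qed.

(* [CSeries] being total, convergence of both series is part of the claim. *)
Theorem mainTheorem1 (n : nat) (hn : (1 <= n)%nat)
  (alpha : nat -> R) (nu : nat -> C)
  (halpha : forall j : nat, (1 <= j <= n + 1)%nat -> alpha j = 1%R)
  (ha : forall j : nat, (1 <= j <= n)%nat ->
        forall m : nat, (1 <= m)%nat -> a_par alpha nu j <> RtoC (- INR m))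
  (z : C) :
  @ex_series C_AbsRing C_NormedModule (W_term n alpha nu z) /\
  @ex_series C_AbsRing C_NormedModule
    (hyper_Bessel_term n (fun j => a_par alpha nu (j + 1)) (- z)) /\
  W n alpha nu z =
    Cprod (fun j => Gamma (1 + a_par alpha nu j)) 1 n *
    hyper_Bessel n (fun j => a_par alpha nu (j + 1)) (- z).
Proof.
  set (c := Cprod (fun j => Gamma (1 + a_par alpha nu j)) 1 n).
  destruct (ex_series_hyper_Bessel n (fun j => a_par alpha nu (j + 1)) (- z)) as [l hl].
  (* Termwise proportionality carries both convergence and the sum over from the hyper-Bessel
     series. *)
  assert (hW : @is_series C_AbsRing C_NormedModule (W_term n alpha nu z) (c * l)).
  { apply is_series_ext with (2 := is_series_scal (V := C_NormedModule) c _ _ hl).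
    intros k. symmetry. now apply W_term_eq. }
  split; [now exists (c * l)|]. split; [now exists l|].
  unfold W, hyper_Bessel. now rewrite (CSeries_unique _ _ hW), (CSeries_unique _ _ hl).
Qed.
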